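(* For the boundary Markov chain $(M_n)$ started from any fixed initial state and any $\varepsilon>0$, almost surely \[ \lim_{n\to\infty} \frac{M_n \log^{2+\varepsilon} n}{n^{2/3}} = \infty . \]
   Context: The boundary Markov chain is the Markov chain $(M_n)_{n\ge0}$ on $\{0,1,2,\dots\}$ with $M_{n+1}=M_n+X_n$. Given $M_n=m$, its step $X_n$ has the law \[ \mathbb P(X_n=1\mid M_n=m)=\frac{2m+3}{3m+3}. \] For $1\le k\le m$, \[ \mathbb P(X_n=-k\mid M_n=m)=\frac{2(2k-2)!}{(k-1)!(k+1)!}\cdot\frac{m!^2(2m-2k+1)!}{(m-k)!^2(2m+1)!}. \] *)

(* Defs.v *)
From HB Require Import structures.
From mathcomp Require Import all_boot all_order all_algebra.
From mathcomp Require Import all_classical all_reals all_analysis.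
Set Implicit Arguments. Unset Strict Implicit. Unset Printing Implicit Defensive.
Import Order.TTheory GRing.Theory Num.Theory.
Local Open Scope ring_scope.
Local Open Scope classical_set_scope.

Definition bmc_trans (R : realType) (m j : nat) : R :=
  if j == m.+1 then (2 * m + 3)%:R / (3 * m + 3)%:R
  else if (j < m)%N then
    let k := (m - j)%N in
    (2 * (2 * k - 2)`!)%:R / ((k.-1)`! * (k.+1)`!)%:R *
    (((m`! ^ 2) * (2 * m - 2 * k + 1)`!)%:R /
     (((m - k)`! ^ 2) * (2 * m + 1)`!)%:R)
  else 0.

Definition is_boundary_chain (d : measure_display) (T : measurableType d)
  (R : realType) (P : probability T R) (m0 : nat) (M : nat -> T -> nat) : Prop :=
  [/\ (forall n x, measurable (M n @^-1` [set x])),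
      P (M 0%N @^-1` [set m0]) = 1%E &
      forall (n : nat) (x : nat -> nat),
        P [set w | forall i, (i <= n.+1)%N -> M i w = x i] =
        (P [set w | forall i, (i <= n)%N -> M i w = x i] *
         (bmc_trans R (x n) (x n.+1))%:E)%E].

(* Main.v *)
(** Let [harm m] have generating function [(1-z)^(-3/2)]; it grows like [sqrt m].
    The chain is the [harm]-transform of a centred walk, upward skip-free and
    killed below [0], whose jump law has generating function
    [1 + (2/3) (1-z)^(3/2) / z] (a jump [-k] being marked [z^k]).  Two explicit
    potentials follow.
    - [1 / harm] is superharmonic, so after exceeding [L] the chain ever reaches
      [harm <= c] with probability at most [c / harm L].
    - [E f(M_1) = f(M_0) + 1] is solved by [f m = (3/4) m (m+1) / harm m], whose
      numerator has generating function [(3/2) z (1-z)^(-3)]; [f] is of order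
      [m^(3/2)], so the probability of staying below [L] up to time [t] decays
      like [exp (- t / (2 f(L)))].
    At the scales [L = 4^j], Borel-Cantelli for both events shows that eventually
    [4^j] is exceeded before time [O(8^j log j)], and that from then on
    [harm (M_n) > 2^j / j^(1+eps/4)]. *)
Require Import Defs.
From HB Require Import structures.
From mathcomp Require Import all_boot all_order all_algebra.
From mathcomp Require Import all_classical all_reals all_analysis.
From mathcomp Require Import ring lra zify.
Import Order.TTheory GRing.Theory Num.Theory.
Local Open Scope ring_scope.
Local Open Scope classical_set_scope.

(** * The transformed walk *)

Section RenewalIdentities.
Context {R : realType}.
Implicit Types m n k j : nat.

Definition harm m : R := ((2 * m + 1)`!)%:R / ((m`! ^ 2) * 4 ^ m)%:R.

(* The law of the untransformed walk. *)
Definition down_step k : R :=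
  (2 * (2 * k - 2)`!)%:R / ((k.-1)`! * (k.+1)`!)%:R / 4 ^+ k.

Lemma harm0 : harm 0 = 1.
Proof. by rewrite /harm /= divr1. Qed.

Lemma harm_gt0 m : 0 < harm m.
Proof. by rewrite divr_gt0 // ltr0n ?muln_gt0 ?expn_gt0 fact_gt0. Qed.

Lemma harm_neq0 m : harm m != 0.
Proof. by rewrite gt_eqF ?harm_gt0. Qed.

Lemma harmS m : harm m.+1 = harm m * ((2 * m + 3)%:R / (2 * m + 2)%:R).
Proof.
rewrite /harm.
have -> : (2 * m.+1 + 1 = (2 * m + 1).+2)%N by lia.
rewrite !factS expnS !natrM !natrX.
rewrite exprS.
have h0 : (m`!%:R : R) != 0 by rewrite pnatr_eq0 -lt0n fact_gt0.
have k0 : 0 <= (m%:R : R) by [].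
have h2 : (4 ^+ m : R) != 0 by rewrite expf_neq0.
by field; rewrite h0 h2 !lt0r_neq0 //; lra.
Qed.

(** Puts jump weights and [harm] on a common factor, so that the inductions below become identities
    between rational functions of [m] times [harm m]. *)
Lemma down_stepE k :
  down_step k.+1 =
  harm k.+1 / ((2 * k + 3)%:R * (2 * k + 1)%:R * (k + 2)%:R).
Proof.
rewrite harmS /down_step /harm /=.
have -> : (2 * k.+1 - 2 = 2 * k)%N by lia.
rewrite addn1 !factS exprS !natrM !natrX.
have h0 : (k`!%:R : R) != 0 by rewrite pnatr_eq0 -lt0n fact_gt0.
have k0 : 0 <= (k%:R : R) by [].
have h2 : (4 ^+ k : R) != 0 by rewrite expf_neq0.
field.
by rewrite h0 h2 !lt0r_neq0 //; lra.
Qed.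

Lemma transE_up m : bmc_trans R m m.+1 = 2 / 3 * (harm m.+1 / harm m).
Proof.
rewrite /bmc_trans eqxx harmS [harm m * _]mulrC mulfK ?harm_neq0 //.
have k0 : 0 <= (m%:R : R) by [].
field; rewrite !lt0r_neq0 //; lra.
Qed.

Lemma transE_down m j : (j < m)%N ->
  bmc_trans R m j = down_step (m - j) * (harm j / harm m).
Proof.
move=> jm; rewrite /bmc_trans jm ltn_eqF; last lia.
rewrite /down_step /harm.
have -> : (2 * m - 2 * (m - j) + 1 = 2 * j + 1)%N by lia.
have -> : (m - (m - j) = j)%N by lia.
have -> : (4 ^ m = 4 ^ (m - j) * 4 ^ j)%N by rewrite -expnD subnK // ltnW.
rewrite -[RHS]mulrA; congr (_ * _).
have h0 i : (i`!%:R : R) != 0 by rewrite pnatr_eq0 -lt0n fact_gt0.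
have h2 i : (4 ^+ i : R) != 0 by rewrite expf_neq0.
rewrite !(natrM, natrX).
move: (h0 m) (h0 j) (h0 (2 * m + 1)%N) (h2 (m - j)%N) (h2 j).
move: (m`!%:R) (j`!%:R) ((2 * m + 1)`!%:R) (4 ^+ (m - j)) (4 ^+ j) => a b c e f.
by move=> a0 b0 c0 e0 f0; field; rewrite f0 e0 a0 c0 b0.
Qed.

Lemma transE_same m : bmc_trans R m m = 0.
Proof. by rewrite /bmc_trans ltnn ltn_eqF. Qed.

Lemma trans_gt m j : (m.+1 < j)%N -> bmc_trans R m j = 0.
Proof. by move=> mj; rewrite /bmc_trans gtn_eqF // ltnNge (ltnW (ltnW mj)). Qed.

Lemma trans_ge0 m j : 0 <= bmc_trans R m j.
Proof.
rewrite /bmc_trans; case: ifP => _; first by rewrite divr_ge0.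
by case: ifP => // _; rewrite mulr_ge0 ?divr_ge0.
Qed.

(** Undoes the transform: for [u = g / harm] the factors [harm j] cancel, leaving a convolution of
    [g] with the plain jump law. *)
Lemma sum_trans m (u : nat -> R) :
  \sum_(j < m.+2) bmc_trans R m j * u j =
  (\sum_(k < m) down_step k.+1 * (harm (m - k.+1) * u (m - k.+1)%N)
   + 2 / 3 * (harm m.+1 * u m.+1)) / harm m.
Proof.
rewrite big_ord_recr big_ord_recr /= transE_same mul0r addr0 transE_up [RHS]mulrDl.
congr (_ + _); last by rewrite !mulrA [RHS]mulrAC.
rewrite (reindex_inj rev_ord_inj) /= mulr_suml; apply: eq_bigr => k _.
rewrite transE_down; last by have := ltn_ord k; lia.
have -> : (m - (m - k.+1) = k.+1)%N by have := ltn_ord k; lia.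
by rewrite !mulrA mulrAC.
Qed.

(* The next three closed forms are the coefficients of the jump generating
   function divided by [1-z], [(1-z)^2] and [(1-z)^3]. *)
Lemma sum_down_step m :
  \sum_(k < m) down_step k.+1 =
  1 / 3 - harm m / (3 * ((m + 1)%:R * (2 * m + 1)%:R)).
Proof.
elim: m => [|m IH]; first by rewrite big_ord0 harm0; field.
rewrite big_ord_recr /= IH down_stepE harmS.
have k0 : 0 <= (m%:R : R) by [].
field; rewrite !lt0r_neq0 //; lra.
Qed.

Lemma sum_down_step1 m :
  \sum_(k < m) down_step k.+1 * (m - k)%:R =
  (m%:R - 1) / 3 + harm m / (3 * (m + 1)%:R).
Proof.
elim: m => [|m IH]; first by rewrite big_ord0 harm0; field.
(* Passing from [m] to [m.+1] raises every weight by 1, which adds a partial sum of the jump law. *)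
have -> : \sum_(k < m.+1) down_step k.+1 * (m.+1 - k)%:R =
   \sum_(k < m) down_step k.+1 * (m - k)%:R + \sum_(k < m.+1) down_step k.+1.
  rewrite [in RHS]big_ord_recr big_ord_recr /= addrA -big_split /= subSnn mulr1.
  congr (_ + _); apply: eq_bigr => k _.
  by rewrite subSn ?(ltnW (ltn_ord k)) // -natr1 mulrDr mulr1.
rewrite sum_down_step IH harmS.
have k0 : 0 <= (m%:R : R) by [].
field; rewrite !lt0r_neq0 //; lra.
Qed.

Lemma sum_down_step2 m :
  \sum_(k < m) down_step k.+1 * (3 / 4 * (m - k.+1)%:R * (m - k)%:R) =
  3 / 4 * m%:R * (m + 1)%:R + harm m - (m + 1)%:R * (m + 2)%:R / 2.
Proof.
elim: m => [|m IH]; first by rewrite big_ord0 harm0; field.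
(* The quadratic weight grows by [3/2 * (m - k)], so the increment is the linear sum just
   computed. *)
have -> : \sum_(k < m.+1) down_step k.+1 *
      (3 / 4 * (m.+1 - k.+1)%:R * (m.+1 - k)%:R) =
   \sum_(k < m) down_step k.+1 * (3 / 4 * (m - k.+1)%:R * (m - k)%:R) +
   3 / 2 * \sum_(k < m) down_step k.+1 * (m - k)%:R.
  rewrite big_ord_recr /= subnn mulr0 mul0r mulr0 addr0.
  rewrite mulr_sumr -big_split /=; apply: eq_bigr => k _.
  rewrite subSS.
  have -> : (m.+1 - k = (m - k.+1) + 2)%N by have := ltn_ord k; lia.
  have -> : (m - k = (m - k.+1) + 1)%N by have := ltn_ord k; lia.
  by rewrite !natrD; field.
rewrite sum_down_step1 IH harmS.
have k0 : 0 <= (m%:R : R) by [].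
field; rewrite !lt0r_neq0 //; lra.
Qed.

Definition passage m : R := 3 / 4 * m%:R * (m + 1)%:R / harm m.

(** Since [harm * passage] is a polynomial, [sum_down_step2] applies. The upward jump contributes
    [(m+1)(m+2)/2], cancelling the last term there, and the remaining [harm m] becomes the [+ 1]
    after division. *)
Lemma trans_passage m :
  \sum_(j < m.+2) bmc_trans R m j * passage j = passage m + 1.
Proof.
have E i : harm i * passage i = 3 / 4 * i%:R * (i + 1)%:R.
  by rewrite /passage mulrC divfK ?harm_neq0.
rewrite (sum_trans m passage) E.
under eq_bigr => k _.
  rewrite E.
  have -> : ((m - k.+1) + 1 = m - k)%N by have := ltn_ord k; lia.
  over.
rewrite sum_down_step2 /passage.
by field; exact: harm_neq0.
Qed.

(** After cancellation the sum is the total mass of one step of the killed walk; the deficit from 1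
    is the killing probability. *)
Lemma trans_harmV m :
  \sum_(j < m.+2) bmc_trans R m j * (harm j)^-1 <= (harm m)^-1.
Proof.
rewrite (sum_trans m (fun j => (harm j)^-1)) mulfV ?harm_neq0 // mulr1.
under eq_bigr => k _ do rewrite mulfV ?harm_neq0 // mulr1.
rewrite sum_down_step; apply: ler_piMl; first by rewrite invr_ge0 ltW ?harm_gt0.
set x := harm m / _.
have : 0 <= x by rewrite divr_ge0 ?ltW ?harm_gt0.
lra.
Qed.

Lemma harm_nondecreasing : {homo harm : m n / (m <= n)%N >-> m <= n}.
Proof.
apply: homo_leq => // [x y z|m]; first exact: le_trans.
rewrite harmS ler_peMr ?(ltW (harm_gt0 _)) // ler_pdivlMr ?mul1r ?ler_nat ?ltr0n; lia.
Qed.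

(** Squaring avoids square roots. The squared ratio from [harmS] lies between [(m+2)/(m+1)] and
    [(2m+3)/(2m+1)], which gives this bound and the next one. *)
Lemma harm_sqr_ge m : (m + 1)%:R <= harm m ^+ 2.
Proof.
elim: m => [|m IH]; first by rewrite harm0 expr1n.
rewrite harmS exprMn.
have k0 : 0 <= (m%:R : R) by [].
apply: (le_trans _ (ler_wpM2r (sqr_ge0 _) IH)).
rewrite expr_div_n mulrA ler_pdivlMr; nra.
Qed.

Lemma harm_sqr_le m : harm m ^+ 2 <= (2 * m + 1)%:R.
Proof.
elim: m => [|m IH]; first by rewrite harm0 expr1n.
rewrite harmS exprMn.
have k0 : 0 <= (m%:R : R) by [].
apply: (le_trans (ler_wpM2r (sqr_ge0 _) IH)).
rewrite expr_div_n mulrA ler_pdivrMr; nra.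
Qed.

Lemma passage_ge0 m : 0 <= passage m.
Proof. by rewrite /passage divr_ge0 ?(ltW (harm_gt0 _)) // ?mulr_ge0. Qed.

Lemma passage_nondecreasing : {homo passage : m n / (m <= n)%N >-> m <= n}.
Proof.
apply: homo_leq => // [x y z|m]; first exact: le_trans.
have k0 : 0 <= (m%:R : R) by [].
have -> : passage m.+1 = 3 / 4 * m.+1%:R * (m.+1 + 1)%:R *
    (2 * m + 2)%:R / (2 * m + 3)%:R / harm m.
  rewrite /passage harmS; field.
  by rewrite harm_neq0 !lt0r_neq0 //; lra.
rewrite /passage ler_wpM2r ?invr_ge0 ?(ltW (harm_gt0 _)) // ler_pdivlMr; nra.
Qed.

Lemma passage_sqr_le m : passage m ^+ 2 <= m%:R ^+ 2 * (m + 1)%:R.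
Proof.
rewrite /passage expr_div_n ler_pdivrMr ?exprn_gt0 ?harm_gt0 //.
apply: (le_trans _ (ler_wpM2l _ (harm_sqr_ge m))); last by rewrite mulr_ge0 ?sqr_ge0.
have : 0 <= (m%:R * (m + 1)%:R : R) ^+ 2 by exact: sqr_ge0.
lra.
Qed.

End RenewalIdentities.

(** * Supermartingale bounds along histories *)

(** Newest state first, so that the current state is the head and a step of the chain is a cons. *)
Fixpoint history {T : Type} (M : nat -> T -> nat) n w : seq nat :=
  if n is n'.+1 then M n w :: history M n' w else [:: M 0%N w].

Lemma history_eqP {T : Type} (M : nat -> T -> nat) n s : size s = n.+1 ->
  [set w | history M n w = s] =
  [set w | forall i, (i <= n)%N -> M i w = nth 0%N s (n - i)].
Proof.
elim: n s => [|n IH] [|x s] //= [ss].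
  case: s ss => // _; apply/seteqP; split => w /=.
    by move=> [<-] i; rewrite leqn0 => /eqP ->.
  by move=> /(_ 0%N (leqnn _)) ->.
have := IH s ss => /seteqP [h1 h2].
apply/seteqP; split => w /=.
  move=> [Mx hs] i; rewrite leq_eqVlt => /orP[/eqP ->|]; first by rewrite subnn.
  by rewrite ltnS => iN; rewrite subSn //=; exact: (h1 w).
move=> H; have := H n.+1 (leqnn _); rewrite subnn /= => ->.
congr (_ :: _); apply: h2 => i iN.
by rewrite H ?(leqW iN) // subSn.
Qed.

Section PotentialBound.
Context {d : measure_display} {T : measurableType d} {R : realType}.
Context {P : probability T R} {m0 : nat} {M : nat -> T -> nat}.
Hypothesis hM : is_boundary_chain P m0 M.

(** There are countably many histories, so any set of them gives a countable union of cylinder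
    events. *)
Lemma measurable_history n (B : set (seq nat)) :
  measurable [set w | B (history M n w)].
Proof.
have [mM _ _] := hM.
have m1 s : measurable [set w | history M n w = s].
  elim: n s => [|n IH] [|x s] /=.
  - by rewrite (_ : [set _ | _] = set0) //; apply/seteqP; split.
  - case: s => [|y s].
      rewrite (_ : [set _ | _] = M 0%N @^-1` [set x]) //.
      by apply/seteqP; split => w /= => [[]|->].
    by rewrite (_ : [set _ | _] = set0) //; apply/seteqP; split.
  - by rewrite (_ : [set _ | _] = set0) //; apply/seteqP; split.
  rewrite (_ : [set _ | _] =
    M n.+1 @^-1` [set x] `&` [set w | history M n w = s]).
    by apply: measurableI.
  by apply/seteqP; split => w /= => [[-> ->]|[-> ->]].
rewrite (_ : [set _ | _] =
  \bigcup_s [set w | B s /\ history M n w = s]); last first.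
  apply/seteqP; split => w /=; first by exists (history M n w).
  by move=> [s _ [Bs ->]].
apply: countable_bigcupT_measurable => // s.
have [Bs|nBs] := pselect (B s).
  by rewrite (_ : [set _ | _] = [set w | history M n w = s]) //;
    apply/seteqP; split => w //= [].
by rewrite (_ : [set _ | _] = set0) //; apply/seteqP; split => w //= [].
Qed.

Lemma measurable_history_eq n s : measurable [set w | history M n w = s].
Proof. exact: (measurable_history n [set s]). Qed.

Lemma prob_history_cons n s j : size s = n.+1 ->
  P [set w | history M n.+1 w = j :: s] =
  (P [set w | history M n w = s] * (bmc_trans R (head 0%N s) j)%:E)%E.
Proof.
move=> ss; have [_ _ hp] := hM.
rewrite !history_eqP //=; last by rewrite ss.
have := hp n (fun i => nth 0%N (j :: s) (n.+1 - i)).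
rewrite subnn subSnn => ->; congr (P _ * (bmc_trans R _ _)%:E)%E.
by apply/seteqP; split => w /= H i iN; have := H i iN; rewrite subSn.
Qed.

(** The events are disjoint because they fix different next states; the series is finite because
    upward jumps larger than 1 have probability 0. *)
Lemma prob_history_cases n s (F : nat -> set T) : size s = n.+1 ->
  (forall j, measurable (F j)) ->
  (forall j, F j `<=` [set w | history M n.+1 w = j :: s]) ->
  P (\bigcup_j F j) = (\sum_(j < (head 0%N s).+2) P (F j))%E.
Proof.
move=> ss mF subF.
rewrite measure_semi_bigcup //; last 2 first.
- move=> i j _ _ [w [/subF /= wi /subF /= wj]].
  by move: wi; rewrite wj => -[].
- exact: bigcupT_measurable.
rewrite (nneseries_split 0 (head 0%N s).+2); last by move=> *; exact: measure_ge0.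
rewrite add0n eseries0 ?adde0 ?big_mkord // => j jm _.
apply/eqP; rewrite -measure_le0.
apply: (@le_trans _ _ (P [set w | history M n.+1 w = j :: s])).
  by rewrite le_measure ?inE //; exact: measurable_history_eq.
by rewrite prob_history_cons // trans_gt ?mule0.
Qed.

(* That the jump probabilities from a reachable state add up to 1 is read off
   the hypothesis on the chain rather than from their formula. *)
Lemma sum_trans1 n s : size s = n.+1 -> P [set w | history M n w = s] != 0%E ->
  \sum_(j < (head 0%N s).+2) bmc_trans R (head 0%N s) j = 1.
Proof.
move=> ss.
have := @prob_history_cases n s
  (fun j => [set w | history M n.+1 w = j :: s]) ss
  (fun j => measurable_history_eq n.+1 (j :: s)) (fun j w H => H).
rewrite (_ : \bigcup_j _ = [set w | history M n w = s]); last first.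
  apply/seteqP; split => w /=; first by move=> [j _ [_ ->]].
  by move=> <-; exists (M n.+1 w).
under eq_bigr => j _ do rewrite prob_history_cons //.
have : P [set w | history M n w = s] \is a fin_num.
  by apply: fin_num_measure; exact: measurable_history_eq.
move: (P _) => [p| |] // _.
rewrite sumEFin -mulr_sumr => -[pE]; rewrite eqe => p0.
by apply: (mulfI p0); rewrite mulr1.
Qed.

(* [U r s] bounds the conditional probability, given the (reversed) history [s],
   of [b] holding [r] steps later. *)
Lemma potential_bound_history (b : pred (seq nat)) (U : nat -> seq nat -> R) :
  (forall s, b s -> 1 <= U 0%N s) ->
  (forall r s, 0 <= U r s) ->
  (forall r m s, U r.+1 (m :: s) < 1 ->
    \sum_(j < m.+2) bmc_trans R m j = 1 ->
    \sum_(j < m.+2) bmc_trans R m j * U r [:: (j : nat), m & s]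
      <= U r.+1 (m :: s)) ->
  forall r n s, size s = n.+1 ->
  (P [set w | history M n w = s /\ b (history M (n + r) w)] <=
   P [set w | history M n w = s] * (U r s)%:E)%E.
Proof.
move=> bU U0 UU; elim=> [|r IH] n s ss.
  rewrite addn0; have [bs|nbs] := boolP (b s).
    apply: (@le_trans _ _ (P [set w | history M n w = s])).
      rewrite le_measure ?inE //; last by move=> w [].
        exact: (measurable_history n [set t | t = s /\ b t]).
      exact: measurable_history_eq.
    by rewrite lee_pemulr ?measure_ge0 // lee_fin bU.
  rewrite (_ : [set w | _ /\ _] = set0) ?measure0 ?mule_ge0 ?measure_ge0 ?lee_fin //.
  apply/seteqP; split => w //= [->]; exact/negP.
have mb k l B : measurable [set w | history M k w = B /\ b (history M l w)].
  by apply: measurableI; [exact: (measurable_history k [set t | t = B])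
                         | exact: (measurable_history l [set t | b t])].
have leP0 : (P [set w | history M n w = s /\ b (history M (n + r.+1) w)] <=
    P [set w | history M n w = s])%E.
  by rewrite le_measure ?inE //; [exact: measurable_history_eq|move=> w []].
(* Where [U] is at least 1 the bound is trivial; this is why the one-step inequality is only asked
   for where [U < 1]. *)
have [U1|U1] := leP 1 (U r.+1 s).
  by apply: (le_trans leP0); rewrite lee_pemulr ?measure_ge0 // lee_fin.
(* On a null history both sides vanish; otherwise [sum_trans1] provides total mass 1. *)
have [Pz|Pn0] := eqVneq (P [set w | history M n w = s]) 0%E.
  by move: leP0; rewrite Pz mul0e.
have tot := sum_trans1 _ _ ss Pn0.
case: s ss => [//|m s] ss in leP0 U1 Pn0 tot *.
rewrite (_ : [set w | _ /\ _] = \bigcup_j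
    [set w | history M n.+1 w = [:: j, m & s] /\ b (history M (n.+1 + r) w)]); last first.
  rewrite addSnnS; apply/seteqP; split => w /=.
    by move=> [hs bw]; exists (M n.+1 w) => //=; rewrite hs.
  by move=> [j _ [[_ ->]]].
rewrite (@prob_history_cases n (m :: s)) //; last by move=> j w [].
apply: (@le_trans _ _ (\sum_(j < m.+2) P [set w | history M n w = m :: s] *
   (bmc_trans R m j * U r [:: (j : nat), m & s])%:E)%E).
  apply: lee_sum => j _; apply: (le_trans (IH _ _ _)); first by rewrite /= -ss.
  by rewrite prob_history_cons // EFinM muleA.
rewrite -ge0_sume_distrr; last first.
  by move=> j _; rewrite lee_fin mulr_ge0 // trans_ge0.
by rewrite sumEFin lee_wpmul2l ?measure_ge0 // lee_fin UU.
Qed.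

Lemma potential_bound (b : pred (seq nat)) (U : nat -> seq nat -> R) :
  (forall s, b s -> 1 <= U 0%N s) ->
  (forall r s, 0 <= U r s) ->
  (forall r m s, U r.+1 (m :: s) < 1 ->
    \sum_(j < m.+2) bmc_trans R m j = 1 ->
    \sum_(j < m.+2) bmc_trans R m j * U r [:: (j : nat), m & s]
      <= U r.+1 (m :: s)) ->
  forall n, (P [set w | b (history M n w)] <= (U n [:: m0])%:E)%E.
Proof.
move=> bU U0 UU n; have [mM PM0 _] := hM.
have := @potential_bound_history b U bU U0 UU n 0%N [:: m0] erefl.
have -> : [set w | history M 0 w = [:: m0]] = M 0%N @^-1` [set m0].
  by apply/seteqP; split => w /= => [[]|->].
rewrite PM0 mul1e add0n; apply: le_trans.
set B := [set w | b _].
have mB : measurable B by exact: (measurable_history n [set t | b t]).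
have mA := mM 0%N m0.
have mC : measurable (~` (M 0%N @^-1` [set m0])) by exact: measurableC.
have PC : P (~` (M 0%N @^-1` [set m0])) = 0%E.
  by rewrite probability_setC // PM0 subee.
have mI : measurable (M 0%N @^-1` [set m0] `&` B) by exact: measurableI.
(* The chain starts at [m0] only almost surely, so the null set of other starts is adjoined. *)
apply: (@le_trans _ _
  (P ((M 0%N @^-1` [set m0] `&` B) `|` ~` (M 0%N @^-1` [set m0])))%E).
  rewrite le_measure ?inE //; first exact: measurableU.
  move=> w Bw; have [] := pselect (M 0%N w = m0); [by left|by right].
rewrite measureU0 // le_measure ?inE //; last by move=> w /= [-> ?].
by apply: measurableI => //; exact: (measurable_history 0 [set [:: m0]]).
Qed.

End PotentialBound.

(* On a reversed history: some value exceeds [L] and a strictly later one has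
   [harm <= c]. *)
Fixpoint dips {R : realType} (L : nat) (c : R) (s : seq nat) : bool :=
  if s is x :: s' then dips L c s' || (harm x <= c) && has (leq L) s'
  else false.

(** * Probabilities of falling back and of staying low *)

Section ExcursionBounds.
Context {d : measure_display} {T : measurableType d} {R : realType}.
Context {P : probability T R} {m0 : nat} {M : nat -> T -> nat}.
Hypothesis hM : is_boundary_chain P m0 M.

(** The potential is 1 after a dip, [c / harm] of the current state once [L] has been reached, and
    the constant [c / harm L] before that. *)
Lemma prob_dips L (c : R) n : 0 < c ->
  (P [set w | dips L c (history M n w)] <= (c / harm L)%:E)%E.
Proof.
move=> c0.
pose U (r : nat) s : R := if dips L c s then 1
  else if has (leq L) s then c / harm (head 0%N s) else c / harm L.
have UhE : U n [:: m0] <= c / harm L.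
  rewrite /U /= andbF orbF; case: ifP => // Lm.
  by rewrite ler_wpM2l ?(ltW c0) // lef_pV2 ?posrE ?harm_gt0 // harm_nondecreasing.
apply: (@le_trans _ _ (U n [:: m0])%:E); last by rewrite lee_fin.
apply: (potential_bound hM) => [s|r s|r m s].
- by rewrite /U => ->.
- by rewrite /U; case: ifP => // _; case: ifP => _;
    rewrite divr_ge0 ?(ltW c0) ?(ltW (harm_gt0 _)).
rewrite {1 3}/U; case: ifPn => [|nd]; first by rewrite ltxx.
(* Once [L] has been reached, [c / harm j] dominates the new potential, being at least 1 at a dip,
   and [trans_harmV] concludes. Before that, no dip can occur at this step, and landing at or above
   [L] can only lower the potential. *)
case: ifPn => [hs|nhs] _ p1.
  apply: (@le_trans _ _ (\sum_(j < m.+2) bmc_trans R m j * (c * (harm j)^-1))).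
    apply: ler_sum => j _; rewrite ler_wpM2l ?trans_ge0 // /U.
    case: ifPn => [|_]; last by rewrite [has _ _]/= -/(has _ (m :: s)) hs orbT.
    rewrite [dips _ _ _]/= -/(dips L c (m :: s)) (negbTE nd) /= => /andP[hj _].
    by rewrite ler_pdivlMr ?harm_gt0 // mul1r.
  under eq_bigr => j _ do rewrite mulrCA.
  by rewrite -mulr_sumr ler_wpM2l ?(ltW c0) //; exact: trans_harmV.
apply: (@le_trans _ _ (\sum_(j < m.+2) bmc_trans R m j * (c / harm L))); last first.
  by rewrite -mulr_suml p1 mul1r.
apply: ler_sum => j _; rewrite ler_wpM2l ?trans_ge0 // /U.
have -> : dips L c [:: (j : nat), m & s] = false.
  move: nd nhs.
  rewrite -[dips L c [:: (j : nat), m & s]]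
          /(dips L c (m :: s) || (harm j <= c) && has (leq L) (m :: s)).
  by move=> /negbTE -> /negbTE ->; rewrite andbF.
case: ifPn => [|//].
rewrite -[has _ [:: (j : nat), m & s]]/((L <= j)%N || has (leq L) (m :: s)).
rewrite (negbTE nhs) orbF => Lj.
by rewrite ler_wpM2l ?(ltW c0) // lef_pV2 ?posrE ?harm_gt0 // harm_nondecreasing.
Qed.

Lemma has_history L n w :
  has (leq L) (history M n w) <-> exists2 i, (i <= n)%N & (L <= M i w)%N.
Proof.
elim: n => [|n IH] /=.
  by rewrite orbF; split => [|[i]]; [exists 0%N|rewrite leqn0 => /eqP ->].
split=> [/orP[Ln|/IH[i iN Li]]|[i]]; [by exists n.+1|by exists i => //; exact: leqW|].
rewrite leq_eqVlt => /orP[/eqP -> ->//|iN Li].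
by apply/orP; right; apply/IH; exists i.
Qed.

Lemma dips_history L (c : R) n w : dips L c (history M n w) <->
  exists2 k, (k <= n)%N & harm (M k w) <= c /\ exists2 i, (i < k)%N & (L <= M i w)%N.
Proof.
elim: n => [|n IH] /=.
  rewrite andbF; split => // -[k]; rewrite leqn0 => /eqP -> [_ [i]].
  by rewrite ltn0.
split=> [/orP[/IH[k kn H]|/andP[hc /has_history[i iN Li]]]|[k]].
- by exists k => //; exact: leqW.
- by exists n.+1 => //; split=> //; exists i.
rewrite leq_eqVlt => /orP[/eqP -> [-> [i iN Li]]|kn H].
  by apply/orP; right; apply/has_history; exists i.
by apply/orP; left; apply/IH; exists k.
Qed.

Lemma setE_dips L (c : R) :
  [set w | exists i k, [/\ (i < k)%N, (L <= M i w)%N & harm (M k w) <= c]] =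
  \bigcup_n [set w | dips L c (history M n w)].
Proof.
apply/seteqP; split => w /=.
  move=> [i [k [ik Li hk]]]; exists k => //=.
  by apply/dips_history; exists k => //; split => //; exists i.
move=> [n _ /= /dips_history[k kn [hk [i ik Li]]]].
by exists i, k.
Qed.

Lemma measurable_dips L (c : R) : measurable
  [set w | exists i k, [/\ (i < k)%N, (L <= M i w)%N & harm (M k w) <= c]].
Proof.
rewrite setE_dips; apply: bigcupT_measurable => n.
exact: (measurable_history hM n [set t | dips L c t]).
Qed.

(** The events up to time [n] increase with [n], so the bound uniform in [n] passes to their
    union. *)
Lemma prob_dips_ever L (c : R) : 0 < c ->
  (P [set w | exists i k, [/\ (i < k)%N, (L <= M i w)%N & (harm (M k w) <= c)%R]] <=
  (c / harm L)%:E)%E.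
Proof.
move=> c0; rewrite setE_dips.
have md n : measurable [set w | dips L c (history M n w)].
  exact: (measurable_history hM n [set t | dips L c t]).
have nd : nondecreasing_seq (fun n => [set w | dips L c (history M n w)]).
  move=> k n kn; apply/subsetPset => w /= /dips_history[i ik H].
  by apply/dips_history; exists i => //; exact: leq_trans ik kn.
have cv := nondecreasing_cvg_mu (mu := P) md (bigcupT_measurable _ md) nd.
rewrite -(cvg_lim _ cv) //; apply: lime_le; first by apply/cvg_ex; eexists; exact: cv.
by apply: nearW => n; exact: prob_dips.
Qed.

(** By monotonicity, from [passage 1 = 1]. *)
Lemma passage_ge1 L : (0 < L)%N -> 1 <= passage L :> R.
Proof.
move=> L0; apply: le_trans (passage_nondecreasing _ _ L0).
by rewrite /passage harmS harm0 mul1r !muln0 !add0n ler_pdivlMr ?divr_gt0 //; lra.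
Qed.

(** While the chain is below [L], the quantity [2 - passage / F] stays between 1 and 2 and drops by
    [1 / F] per step on average, hence by at least the fraction [1 / (2 F)] of itself. *)
Lemma prob_below L n : (0 < L)%N ->
  (P [set w | forall i, (i <= n)%N -> (M i w < L)%N] <=
   (2 * (1 - (2 * passage L)^-1) ^+ n)%:E)%E.
Proof.
move=> L0; set F := passage L; set q := 1 - _.
have F1 : 1 <= F by exact: passage_ge1.
have F0 : 0 < F by lra.
have q0 : 0 <= q by rewrite subr_ge0 invf_le1; lra.
have -> : [set w | forall i, (i <= n)%N -> (M i w < L)%N] =
    [set w | all (ltn^~ L) (history M n w)].
  apply/seteqP; split => w /=.
    move=> H; apply/negbNE; rewrite -has_predC; apply/negP.
    rewrite (eq_has (a2 := leq L)); last by move=> x /=; rewrite -leqNgt.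
    by move=> /has_history[i iN]; rewrite leqNgt H.
  move=> H i iN; rewrite ltnNge; apply/negP => Li; move: H; apply/negP.
  rewrite -has_predC (eq_has (a2 := leq L)); last by move=> x /=; rewrite -leqNgt.
  by apply/has_history; exists i.
pose U (r : nat) s : R :=
  if all (ltn^~ L) s then (2 - passage (head 0%N s) / F) * q ^+ r else 0.
have f_le m : (m <= L)%N -> 0 <= passage m / F <= 1.
  by move=> mL; rewrite divr_ge0 ?passage_ge0 ?(ltW F0) //= ler_pdivrMr //
    mul1r passage_nondecreasing.
have fh s : all (ltn^~ L) s -> 0 <= passage (head 0%N s) / F <= 1.
  (* The empty list has default head 0, which also satisfies [f_le]. *)
  by case: s => [_|m s /= /andP[/ltnW]]; [rewrite f_le|move=> mL _; exact: f_le].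
have Um0 : U n [:: m0] <= 2 * q ^+ n.
  rewrite /U; case: ifP => [/fh /andP[h0 _]|_].
    by rewrite ler_wpM2r ?exprn_ge0 //; lra.
  by rewrite mulr_ge0 ?exprn_ge0.
apply: (@le_trans _ _ (U n [:: m0])%:E); last by rewrite lee_fin.
apply: (potential_bound hM) => [s|r s|r m s].
- by move=> alls; rewrite /U alls expr0 mulr1; have /andP[_ h1] := fh _ alls; lra.
- rewrite /U; case: ifPn => // /fh /andP[_ h1].
  by rewrite mulr_ge0 ?exprn_ge0 //; lra.
move=> _ p1; rewrite {2}/U; case: ifPn => [|nall]; last first.
  rewrite big1 // => j _; rewrite /U.
  rewrite -[all _ [:: (j : nat), m & s]]/((j < L)%N && all (ltn^~ L) (m :: s)).
  by rewrite (negbTE nall) andbF mulr0.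
move=> allms; have /andP[mL _] := allms.
have := f_le m (ltnW mL); rewrite [head _ _]/=; move=> /andP[x0 x1].
apply: (@le_trans _ _
  (\sum_(j < m.+2) bmc_trans R m j * ((2 - passage j / F) * q ^+ r))).
  apply: ler_sum => j _; rewrite ler_wpM2l ?trans_ge0 // /U.
  case: ifPn => // _.
  (* Upward jumps of size 1 cannot overshoot [L], so the expression replacing the potential 0 at
     exit is still nonnegative. *)
  have /andP[_ y1] := f_le j (leq_trans (ltn_ord j : (j <= m.+1)%N) mL).
  by rewrite mulr_ge0 ?exprn_ge0 //; lra.
have -> : \sum_(j < m.+2) bmc_trans R m j * ((2 - passage j / F) * q ^+ r) =
   (2 * (\sum_(j < m.+2) bmc_trans R m j) -
    (\sum_(j < m.+2) bmc_trans R m j * passage j) / F) * q ^+ r.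
  rewrite mulr_sumr mulr_suml -sumrB mulr_suml; apply: eq_bigr => j _.
  by rewrite mulrA; congr (_ * _); rewrite mulrBr mulrA [_ * 2]mulrC.
(* With [x = passage m / F], what remains is [2 - x - 1/F <= (2 - x) (1 - 1/(2F))], which amounts to
   [x >= 0]. *)
rewrite p1 trans_passage exprS mulrA ler_wpM2r ?exprn_ge0 //.
have y0 : 0 <= F^-1 by rewrite invr_ge0 ltW.
have := mulr_ge0 x0 y0.
rewrite [(passage m + 1) / F]mulrDl mul1r /q [(2 * F)^-1]invfM.
move: (passage m / F) (F^-1) => x y xy; lra.
Qed.

Lemma measurable_below L n :
  measurable [set w | forall i, (i <= n)%N -> (M i w < L)%N].
Proof.
have [mM _ _] := hM.
rewrite (_ : [set _ | _] = \bigcap_(i in [set k | (k <= n)%N])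
   (M i @^-1` [set k | (k < L)%N])) //.
apply: bigcap_measurable; first by exists 0%N.
move=> i _.
rewrite (_ : _ @^-1` _ = \bigcup_(k in [set k | (k < L)%N]) (M i @^-1` [set k])).
  by apply: bigcup_measurable => k _.
apply/seteqP; split => w /=; first by exists (M i w).
by move=> [k kL ->].
Qed.

End ExcursionBounds.

(** * Geometric scales *)

Section PowerEstimates.
Context {R : realType}.

(** Discrete integral comparison: [ln (1+t) <= t] at [t = -1/x] bounds [ln (x-1)], and
    [1+t <= exp t] turns this into the bound on powers. *)
Lemma powR_telescope (eta : R) k : 0 < eta ->
  eta * k.+2%:R `^ (- (1 + eta)) <= k.+1%:R `^ (- eta) - k.+2%:R `^ (- eta).
Proof.
move=> eta0; rewrite -(natr1 k.+1).
have : 0 < k.+1%:R :> R by [].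
move: k.+1%:R => y y0; have [x xE] : exists x, x = y + 1 by exists (y + 1).
rewrite -xE.
have x0 : 0 < x by lra.
have lny : ln y <= ln x - x^-1.
  have -> : y = x * (1 + - x^-1).
    by rewrite mulrDr mulr1 mulrN mulfV ?lt0r_neq0 //; lra.
  have x1 : x^-1 < 1 by rewrite invf_lt1 // xE; lra.
  rewrite lnM ?posrE //; last by lra.
  by rewrite lerD2l le_ln1Dx //; lra.
have -> : x `^ (- (1 + eta)) = x `^ (- eta) * x^-1.
  by rewrite opprD addrC powRD ?lt0r_neq0 ?implybT // powR_inv1 // ltW.
have : x `^ (- eta) * (1 + eta * x^-1) <= y `^ (- eta).
  rewrite /powR !gt_eqF //.
  apply: (@le_trans _ _ (expR (- eta * ln x) * expR (eta * x^-1))).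
    by rewrite ler_wpM2l ?expR_ge0 // expR_ge1Dx.
  rewrite -expRD ler_expR !mulNr; have := ler_wpM2l (ltW eta0) lny; lra.
by move: (_ `^ _) (_ `^ _) => u v; lra.
Qed.

Lemma sum_powR_lt_pinfty (eta C : R) (u : (\bar R)^nat) : 0 < eta -> 0 <= C ->
  (forall k, 0 <= u k)%E ->
  (forall k, u k <= (C * k.+2%:R `^ (- (1 + eta)))%:E)%E ->
  (\sum_(k <oo) u k < +oo)%E.
Proof.
move=> eta0 C0 u0 uC.
apply: (@le_lt_trans _ _ (C / eta)%:E); last exact: ltry.
apply: lime_le; first by apply: is_cvg_nneseries.
apply: nearW => n.
apply: (@le_trans _ _ (\sum_(0 <= k < n)
   (C / eta * (k.+1%:R `^ (- eta) - k.+2%:R `^ (- eta)))%:E)%E).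
  apply: lee_sum => k _; apply: (le_trans (uC k)); rewrite lee_fin.
  rewrite -mulrA ler_wpM2l // ler_pdivlMl //; exact: powR_telescope.
rewrite sumEFin lee_fin -mulr_sumr ler_piMr ?divr_ge0 ?(ltW eta0) //.
have -> : \sum_(0 <= k < n) ((k.+1%:R : R) `^ (- eta) - k.+2%:R `^ (- eta)) =
    1 - n.+1%:R `^ (- eta).
  elim: n => [|n IH]; first by rewrite big_nil powR1 subrr.
  by rewrite big_nat_recr //= IH addrA subrK.
by rewrite lerBlDr lerDl powR_ge0.
Qed.

Lemma ln_le_powR (a x : R) : 0 < a -> 0 < x -> ln x <= x `^ a / a.
Proof.
move=> a0 x0; rewrite ler_pdivlMr // mulrC -ln_powR.
by apply: ltW; apply: ln_sublinear; rewrite powR_gt0.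
Qed.

Lemma near_powR_ge (a A : R) : 0 < a -> \forall j \near \oo, A <= j%:R `^ a.
Proof.
move=> a0; near=> j.
have B0 : 0 <= Num.max A 0 by rewrite le_max lexx orbT.
apply: (@le_trans _ _ (Num.max A 0)); first by rewrite le_max lexx.
have -> : Num.max A 0 = (Num.max A 0 `^ a^-1) `^ a.
  by rewrite -powRrM mulVf ?lt0r_neq0 // powRr1.
rewrite ge0_ler_powR ?(ltW a0) ?nnegrE ?powR_ge0 //.
by near: j; exact: nbhs_infty_ger.
Unshelve. all: by end_near. Qed.

(** In logarithms, with [x = j + 2]: [a ln x <= 2 a sqrt x <= (x - 2) / 2 <= j ln 2], the middle
    inequality holding once [sqrt x >= 4 a + 2]. *)
Lemma near_powR_le_exp2 (a : R) : 0 < a ->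
  \forall j \near \oo, j.+2%:R `^ a <= 2 ^+ j.
Proof.
move=> a0; near=> j.
set x : R := j.+2%:R.
have x0 : 0 < x by rewrite ltr0n.
have l2 : 2^-1 <= ln (2 : R).
  have := @le_ln1Dx R (- 2^-1); rewrite (_ : 1 + - 2^-1 = 2^-1); last by lra.
  by rewrite lnV ?posrE //; lra.
rewrite -ler_ln ?posrE ?powR_gt0 ?exprn_gt0 // ln_powR lnXn // -(mulr_natl _ j).
have h : a * ln x <= a * (2 * x `^ 2^-1).
  rewrite ler_wpM2l ?(ltW a0) //; apply: (le_trans (@ln_le_powR 2^-1 x _ _)) => //.
  by rewrite invrK mulrC.
apply: (le_trans h).
have sx : x `^ 2^-1 * x `^ 2^-1 = x.
  rewrite -powRD ?lt0r_neq0 ?implybT // (_ : 2^-1 + 2^-1 = 1); last by lra.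
  by rewrite powRr1 // ltW.
have jx : j%:R = x - 2 by rewrite /x -2!natr1; lra.
have big : 4 * a + 2 <= x `^ 2^-1.
  apply: (@le_trans _ _ (j%:R `^ 2^-1)); last first.
    by rewrite ge0_ler_powR ?nnegrE ?invr_ge0 ?(ltW x0) // ler_nat leqW.
  by near: j; apply: near_powR_ge; rewrite invr_gt0.
have j2 : j%:R * 2^-1 <= j%:R * ln (2 : R) by rewrite ler_wpM2l.
apply: (le_trans _ j2); rewrite jx -[in leRHS]sx.
move: (x `^ _) big => s; nra.
Unshelve. all: by end_near. Qed.

End PowerEstimates.

(** Borel-Cantelli at a polynomial rate: the limsup set is the exceptional null set. *)
Lemma ae_near_infty_notin d (T : measurableType d) (R : realType)
    (P : probability T R) (F : nat -> set T) (eta C : R) : 0 < eta -> 0 <= C ->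
  (forall k, measurable (F k)) ->
  (forall k, P (F k) <= (C * k.+2%:R `^ (- (1 + eta)))%:E)%E ->
  {ae P, forall w, \forall k \near \oo, ~ F k w}.
Proof.
move=> eta0 C0 mF PF.
have PF0 : P (lim_sup_set F) = 0%E.
  apply: lim_sup_set_cvg0 => //.
  by apply: (@sum_powR_lt_pinfty _ eta C).
exists (lim_sup_set F); split => //.
  apply: bigcap_measurable => [|n _]; first by exists 0%N.
  exact: bigcup_measurable.
move=> w /= nw n _; apply: contrapT => H; apply: nw.
exists n => // k /= nk Fk; apply: H; exists k => //.
Qed.

(** Lies below [harm (4 ^ j)], which is at least [2 ^ j], by just the factor that makes the dip
    probabilities summable. *)
Definition dip_level {R : realType} (delta : R) (j : nat) : R :=
  2 ^+ j * j.+2%:R `^ (- (1 + delta)).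

(* The factor [8 ln] makes the failure probability summable: [exp (-2 ln j)]. *)
Definition deadline (R : realType) (j : nat) : nat :=
  (8 ^ j * (Num.truncn (8 * ln (j.+2%:R : R))).+1)%N.

Section GeometricScales.
Context {R : realType}.

Lemma expr4E j : 4 ^+ j = (2 ^+ j) ^+ 2 :> R.
Proof. by rewrite -exprM mulnC exprM; congr (_ ^+ _); ring. Qed.

Lemma expr8E j : 8 ^+ j = (2 ^+ j) ^+ 3 :> R.
Proof. by rewrite -exprM mulnC exprM; congr (_ ^+ _); ring. Qed.

Lemma harm_pow4_ge j : 2 ^+ j <= harm (4 ^ j) :> R.
Proof.
rewrite -ler_sqr ?nnegrE ?exprn_ge0 ?(ltW (harm_gt0 _)) //.
apply: le_trans (harm_sqr_ge _).
by rewrite natrD natrX expr4E lerDl.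
Qed.

Lemma passage_pow4_le j : passage (4 ^ j) <= 2 * 8 ^+ j :> R.
Proof.
rewrite -ler_sqr ?nnegrE ?passage_ge0 ?mulr_ge0 ?exprn_ge0 //.
apply: (le_trans (passage_sqr_le _)).
rewrite natrD natrX exprMn expr8E expr4E.
have : 1 <= (2 ^+ j) ^+ 2 :> R by rewrite !exprn_ege1 // ler1n.
rewrite [((2 ^+ j) ^+ 3) ^+ 2]exprAC; move: ((2 ^+ j) ^+ 2) => z z1; nra.
Qed.

Lemma dip_level_gt0 (delta : R) j : 0 < dip_level delta j.
Proof. by rewrite mulr_gt0 ?exprn_gt0 ?powR_gt0. Qed.

Lemma deadline_ge j : (j <= deadline R j)%N.
Proof.
by apply: (@leq_trans (8 ^ j)); [apply: ltnW; exact: ltn_expl|exact: leq_pmulr].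
Qed.

(** The power [2/3] turns [8] into [4], and the logarithm is absorbed in a small power. In the
    constant, [2 ^ eta] comes from [j + 3 <= 2 (j + 2)] and [+ 1] from truncation. *)
Lemma deadline_powR_le j (eta : R) : 0 < eta ->
  (deadline R j.+1)%:R `^ (2 / 3) <=
  4 ^+ j.+1 * ((8 * (2 `^ eta / eta) + 1) * j.+2%:R `^ eta).
Proof.
move=> eta0; rewrite /deadline natrM natrX powRM ?exprn_ge0 //.
have -> : (8 ^+ j.+1 : R) `^ (2 / 3) = 4 ^+ j.+1.
  have z0 : 0 <= 2 ^+ j.+1 :> R by rewrite exprn_ge0.
  rewrite expr8E expr4E -(powR_mulrn 3 z0) -(powR_mulrn 2 z0) -powRrM.
  by rewrite mulrC divfK ?pnatr_eq0.
rewrite ler_wpM2l ?exprn_ge0 //.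
set s := Num.truncn _.
apply: (@le_trans _ _ s.+1%:R); first by rewrite ler1_powR ?ler1n //; lra.
have l0 : 0 <= ln (j.+3%:R : R) by rewrite ln_ge0 // ler1n.
have : s%:R <= 8 * ln (j.+3%:R : R) by rewrite truncn_le mulr_ge0.
have : ln (j.+3%:R : R) <= j.+3%:R `^ eta / eta by exact: ln_le_powR.
have : j.+3%:R `^ eta <= 2 `^ eta * j.+2%:R `^ eta.
  rewrite -powRM //; apply: ge0_ler_powR; rewrite ?nnegrE ?(ltW eta0) //.
  by rewrite -natrM ler_nat; lia.
have : 1 <= j.+2%:R `^ eta.
  by rewrite -[leLHS](powRr0 j.+2%:R) ler_powR ?ler1n ?(ltW eta0).
rewrite -natr1 => x1 xx lx sx.
have e0 : 0 <= eta^-1 by rewrite invr_ge0 ltW.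
have := ler_wpM2r e0 xx.
move: lx; rewrite mulrDl mul1r -mulrA [2 `^ eta / eta * _]mulrAC.
by move: (_ / eta) (_ / eta) => p q; lra.
Qed.

(** Deterministic part, with [x = j + 2]. Up to constants, [m] is at least [4^j x^-(2+eps/2)],
    [ln n] at least [x], and [n^(2/3)] at most [4^j x^(eps/4)]; the exponents of [x] leave [eps/4].
    The factor 12 is 3 from the bound on [m] times 4 from [4 ^+ j.+1]. *)
Lemma growth_bound (eps : R) j n m : 0 < eps -> (0 < j)%N ->
  (deadline R j < n <= deadline R j.+1)%N ->
  1 <= dip_level (eps / 4) j -> dip_level (eps / 4) j < harm m ->
  (12 * 4 `^ (2 + eps) * (8 * (2 `^ (eps / 4) / (eps / 4)) + 1))^-1 *
    j.+2%:R `^ (eps / 4) <=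
  m%:R * ln (n%:R : R) `^ (2 + eps) / n%:R `^ (2 / 3).
Proof.
move=> eps0 j0 /andP[jn nj] c1 cm.
set K := 8 * _ + 1.
have K0 : 0 < K by rewrite ltr_wpDl // mulr_ge0 // divr_ge0 ?powR_ge0 //; lra.
set x : R := j.+2%:R.
have x0 : 0 < x by rewrite ltr0n.
have n8 : (8 ^ j <= n)%N.
  apply: leq_trans (ltnW jn); exact: leq_pmulr.
have n0 : (0 < n)%N by rewrite (leq_trans _ n8) // expn_gt0.
have mge : 4 ^+ j * x `^ (- (2 + eps / 2)) / 3 <= m%:R.
  (* As [harm 0 = 1], a level of at least 1 excludes [m = 0]; then [2 m + 1 <= 3 m]. *)
  have m1 : 1 <= m%:R :> R.
    case: m cm => [|m _]; last by rewrite ler1n.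
    by rewrite harm0 ltNge c1.
  have c0 := ltW (dip_level_gt0 (eps / 4) j).
  have : dip_level (eps / 4) j ^+ 2 <= (2 * m + 1)%:R.
    by apply: le_trans (harm_sqr_le m); rewrite ler_sqr ?nnegrE ?(ltW (harm_gt0 _)) // ltW.
  rewrite /dip_level exprMn -expr4E -(powR_mulrn 2 (powR_ge0 _ _)) -powRrM.
  rewrite -/x.
  rewrite (_ : - (1 + eps / 4) * 2%:R = - (2 + eps / 2)); last by lra.
  by rewrite natrD natrM; lra.
have lge : (x / 4) `^ (2 + eps) <= ln (n%:R : R) `^ (2 + eps).
  (* From [ln (1 - 7/8) <= - 7/8]; this suffices for [(j + 2) / 4 <= j ln 8] when [j >= 1]. *)
  have l8 : 7 / 8 <= ln (8 : R).
    have := @le_ln1Dx R (- (7 / 8)); rewrite (_ : 1 + - (7 / 8) = 8^-1); last by lra.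
    by rewrite lnV ?posrE //; lra.
  have lnn : x / 4 <= ln (n%:R : R).
    apply: (@le_trans _ _ (ln (8 ^+ j))).
      rewrite lnXn // -(mulr_natl _ j).
      have j1 : 1 <= j%:R :> R by rewrite ler1n.
      have := ler_wpM2l (ler0n R j) l8.
      by rewrite /x -2!natr1; lra.
    by rewrite ler_ln ?posrE ?exprn_gt0 ?ltr0n // -natrX ler_nat.
  have xx : 0 <= x / 4 by rewrite divr_ge0 // ltW.
  apply: ge0_ler_powR; rewrite ?nnegrE //; first by lra.
  exact: le_trans xx lnn.
have nle : n%:R `^ (2 / 3) <= 4 ^+ j.+1 * (K * x `^ (eps / 4)).
  apply: (@le_trans _ _ ((deadline R j.+1)%:R `^ (2 / 3))).
    by apply: ge0_ler_powR; rewrite ?nnegrE ?ler_nat //; lra.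
  by apply: deadline_powR_le; lra.
have np : 0 < n%:R `^ (2 / 3) :> R by rewrite powR_gt0 ?ltr0n.
rewrite ler_pdivlMr //.
have L0 : 0 < 4 `^ (2 + eps) :> R by rewrite powR_gt0.
have Q0 : 0 <= (12 * 4 `^ (2 + eps) * K)^-1 * x `^ (eps / 4).
  by rewrite mulr_ge0 ?powR_ge0 // invr_ge0 !mulr_ge0 ?(ltW K0) ?(ltW L0).
apply: (le_trans (ler_wpM2l Q0 nle)).
have Z0 : 0 <= 4 ^+ j * x `^ (- (2 + eps / 2)) / 3.
  by rewrite divr_ge0 ?mulr_ge0 ?powR_ge0 ?exprn_ge0.
apply: le_trans (ler_pM Z0 (powR_ge0 _ _) mge lge).
have -> : (x / 4) `^ (2 + eps) = x `^ (2 + eps) / 4 `^ (2 + eps).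
  rewrite powRM ?invr_ge0 ?(ltW x0) //; congr (_ * _).
  by rewrite -powR_inv1 // -powRrM mulN1r powRN.
have xD u v : x `^ u * x `^ v = x `^ (u + v).
  by rewrite powRD // lt0r_neq0 // implybT.
have -> : 4 ^+ j * x `^ (- (2 + eps / 2)) / 3 * (x `^ (2 + eps) / 4 `^ (2 + eps)) =
  4 ^+ j * (x `^ (- (2 + eps / 2)) * x `^ (2 + eps)) / 3 / 4 `^ (2 + eps).
  by field; exact: lt0r_neq0.
rewrite xD (_ : - (2 + eps / 2) + (2 + eps) = eps / 4 + eps / 4); last by lra.
rewrite -xD exprS le_eqVlt; apply/orP; left; apply/eqP.
by field; rewrite !lt0r_neq0.
Qed.

End GeometricScales.

(** * Summable failure probabilities and the almost sure limit *)

Section ScaleProbabilities.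
Context {d : measure_display} {T : measurableType d} {R : realType}.
Context {P : probability T R} {m0 : nat} {M : nat -> T -> nat}.
Hypothesis hM : is_boundary_chain P m0 M.

Lemma prob_dip_level (delta : R) j :
  (P [set w | exists i k, [/\ (i < k)%N, (4 ^ j <= M i w)%N
       & (harm (M k w) <= dip_level delta j)%R]] <=
  (1 * j.+2%:R `^ (- (1 + delta)))%:E)%E.
Proof.
apply: (le_trans (prob_dips_ever hM _ _ (dip_level_gt0 delta j))).
rewrite lee_fin mul1r ler_pdivrMr ?harm_gt0 // /dip_level mulrC.
by rewrite ler_wpM2l ?powR_ge0 // harm_pow4_ge.
Qed.

(** By [1 - t <= exp (-t)] the bound is [exp (- D / (2 F))], where [D >= 8^j * 8 ln (j+2)] and
    [2 F <= 4 * 8^j]. The exponent is written [1 + 1] to match Borel-Cantelli with [eta = 1]. *)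
Lemma prob_deadline j :
  (P [set w | forall i, (i <= deadline R j)%N -> (M i w < 4 ^ j)%N] <=
  (2 * j.+2%:R `^ (- (1 + 1)))%:E)%E.
Proof.
have j4 : (0 < 4 ^ j)%N by rewrite expn_gt0.
apply: (le_trans (prob_below hM _ _ j4)); rewrite lee_fin ler_wpM2l //.
have F1 : 1 <= passage (4 ^ j) :> R by exact: passage_ge1.
have FE : passage (4 ^ j) <= 2 * 8 ^+ j :> R by exact: passage_pow4_le.
move: (passage _) F1 FE => F F1 FE.
have F'0 : 0 < (2 * F)^-1 by rewrite invr_gt0; lra.
have F'1 : (2 * F)^-1 <= 1 by rewrite invf_le1; lra.
apply: (@le_trans _ _ (expR (- (2 * F)^-1) ^+ deadline R j)).
  by rewrite lerXn2r ?nnegrE ?expR_ge0 ?expR_ge1Dx //; lra.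
rewrite -expRM_natl /powR pnatr_eq0 /= ler_expR mulrN mulNr lerN2.
rewrite ler_pdivlMr; last by lra.
have l0 : 0 <= ln (j.+2%:R : R) by rewrite ln_ge0 // ler1n.
have := ltW (truncnS_gt (8 * ln (j.+2%:R : R))).
have z0 : 0 < 8 ^+ j :> R by rewrite exprn_gt0.
rewrite /deadline natrM natrX => /(ler_wpM2l (ltW z0)); apply: le_trans.
have := ler_wpM2l l0 FE; lra.
Qed.

End ScaleProbabilities.

Theorem theorem3p5 (d : measure_display) (T : measurableType d) (R : realType)
  (P : probability T R) (m0 : nat) (M : nat -> T -> nat)
  (hM : is_boundary_chain P m0 M) (eps : R) (heps : 0 < eps) :
  {ae P, forall w,
    (fun n : nat => (M n w)%:R * (ln (n%:R : R)) `^ (2 + eps)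
                    / (n%:R : R) `^ (2 / 3)) @ \oo --> +oo}.
Proof.
have e4 : 0 < eps / 4 by rewrite divr_gt0.
have aeB := ae_near_infty_notin _ _ _ _ _ _ _ e4 ler01
  (fun j => measurable_dips hM (4 ^ j) (dip_level (eps / 4) j))
  (prob_dip_level hM (eps / 4)).
have aeC := ae_near_infty_notin _ _ _ _ _ _ _ ltr01 (ler0n R 2)
  (fun j => measurable_below hM (4 ^ j) (deadline R j)) (prob_deadline hM).
apply: filterS2 aeB aeC => w nB nC; apply/cvgryPge => A.
set K : R := 12 * 4 `^ (2 + eps) * (8 * (2 `^ (eps / 4) / (eps / 4)) + 1).
have K0 : 0 < K.
  rewrite !mulr_gt0 ?powR_gt0 // ltr_wpDl // mulr_ge0 // divr_ge0 ?powR_ge0 //.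
  exact: ltW.
(* For the fixed outcome [w], both failure events have stopped from some scale [J] on. *)
have [J [J0 HJ]] : exists J, (0 < J)%N /\ forall j, (J <= j)%N ->
    [/\ A <= K^-1 * j.+2%:R `^ (eps / 4), 1 <= dip_level (eps / 4) j &
     (exists2 i, (i <= deadline R j)%N & (4 ^ j <= M i w)%N) /\
     forall i k, (i < k)%N -> (4 ^ j <= M i w)%N ->
       dip_level (eps / 4) j < harm (M k w)].
  have : \forall j \near \oo,
    [/\ A <= K^-1 * j.+2%:R `^ (eps / 4), 1 <= dip_level (eps / 4) j &
     (exists2 i, (i <= deadline R j)%N & (4 ^ j <= M i w)%N) /\
     forall i k, (i < k)%N -> (4 ^ j <= M i w)%N ->
       dip_level (eps / 4) j < harm (M k w)].
    near=> j; split.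
    - rewrite ler_pdivlMl //; apply: (@le_trans _ _ (j%:R `^ (eps / 4))).
        by near: j; exact: near_powR_ge.
      by rewrite ge0_ler_powR ?nnegrE ?(ltW e4) // ler_nat leqW.
    - rewrite /dip_level powRN ler_pdivlMr ?powR_gt0 // mul1r.
      by near: j; apply: near_powR_le_exp2; rewrite ltr_wpDl // ltW.
    split.
    - have : ~ (forall i, (i <= deadline R j)%N -> (M i w < 4 ^ j)%N) by near: j.
      move=> /existsNP[i /not_implyP[iD /negP]]; rewrite -leqNgt => Mi.
      by exists i.
    - move=> i k ik Mi; rewrite ltNge; apply/negP => hk.
      have : ~ exists i k, [/\ (i < k)%N, (4 ^ j <= M i w)%N &
        harm (M k w) <= dip_level (eps / 4) j] by near: j.
      by apply; exists i, k.
  by move=> [J _ HJ]; exists J.+1; split => // j /ltnW /HJ.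
exists (deadline R J).+1 => // n /= Jn.
have exj : exists j, (deadline R j < n)%N by exists J.
have ubj j : (deadline R j < n)%N -> (j <= n)%N.
  by move=> /ltnW; apply: leq_trans; exact: deadline_ge.
(* The scale attached to [n] is the last one whose deadline has passed; maximality gives
   [n <= deadline R j.+1]. *)
have [j jn jmax] := ex_maxnP exj ubj.
have Jj : (J <= j)%N by exact: jmax.
have [Aj c1 [[i iD Mi] nd]] := HJ j Jj.
apply: (le_trans Aj); apply: growth_bound => //.
- exact: leq_trans J0 Jj.
- rewrite jn /= leqNgt; apply/negP => /jmax; by rewrite ltnn.
(* Level [4 ^ j] was reached at some time [i <= deadline R j < n], so time [n] falls under the
   no-dip property. *)
- by apply: (nd i) => //; exact: leq_ltn_trans iD jn.
Unshelve. all: by end_near. Qed.
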